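(* Let $T\in M^{m\times n}(\mathbb{C})$, let $T=U_T|T|$ be the polar decomposition of $T$, and consider the proper splitting $T=U_T-V$ of $T$ (so $V=U_T-T$). The following conditions are equivalent: (a) $T^\dagger V\in M^n_+(\mathbb{C})$; (b) $U_T^*V\in M^n_+(\mathbb{C})$; (c) $\|T\|\leq 1$. If any of the conditions (a), (b), (c) holds, then the proper splitting $T=U_T-V$ is convergent.
   Context: $M^{m\times n}(\mathbb{C})$ denotes the complex $m\times n$ matrices; $M^n_+(\mathbb{C})$ is the set of positive semidefinite $n\times n$ complex matrices (i.e. $\langle Ax,x\rangle\ge0$ for all $x\in\mathbb{C}^n$); $\|\cdot\|$ is the spectral norm; $A^\dagger$ is the Moore-Penrose inverse; $\mathcal{R}(\cdot)$, $\mathcal{N}(\cdot)$, $\rho(\cdot)$ denote range, nullspace and spectral radius. The polar decomposition of $T\in M^{m\times n}(\mathbb{C})$ is the unique factorization $T=U_T|T|$ with $|T|=(T^*T)^{1/2}$ and $U_T\in M^{m\times n}(\mathbb{C})$ a partial isometry with $\mathcal{R}(U_T)=\mathcal{R}(T)$; it also satisfies $\mathcal{N}(U_T)=\mathcal{N}(T)$, and $U_T^\dagger=U_T^*$. A decomposition $T=U-V$ with $U,V\in M^{m\times n}(\mathbb{C})$ is a proper splitting of $T$ if $\mathcal{R}(U)=\mathcal{R}(T)$ and $\mathcal{N}(U)=\mathcal{N}(T)$. The proper splitting $T=U-V$ is called convergent if $\rho(U^\dagger V)<1$. *)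

(* Defs.v *)
From mathcomp Require Import all_boot all_order all_algebra.
From mathcomp Require Import boolp classical_sets reals complex.
Set Implicit Arguments.
Unset Strict Implicit.
Unset Printing Implicit Defensive.
Import Order.TTheory GRing.Theory Num.Theory.
Local Open Scope ring_scope.
Local Open Scope sesquilinear_scope.
Local Open Scope complex_scope.
Local Open Scope classical_set_scope.

Section Definitions.
Context {R : realType}.
Local Notation C := R[i].

Definition inner n (x y : 'cV[C]_n) : C := (y ^t* *m x) 0 0.

Definition enorm n (x : 'cV[C]_n) : R := Num.sqrt (complex.Re (inner x x)).

(* [0 <= z] in [R[i]] means that [z] is real and nonnegative. *)
Definition psdmx n (A : 'M[C]_n) : Prop :=
  forall x : 'cV[C]_n, 0 <= inner (A *m x) x.

Definition rangemx m n (A : 'M[C]_(m, n)) : set 'cV[C]_m :=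
  [set A *m x | x in [set: 'cV[C]_n]].

Definition nullmx m n (A : 'M[C]_(m, n)) : set 'cV[C]_n :=
  [set x | A *m x = 0].

Definition specnorm m n (A : 'M[C]_(m, n)) : R :=
  sup [set enorm (A *m x) | x in [set x : 'cV[C]_n | enorm x <= 1]].

(* [eigenvalue] is about row eigenvectors; a square matrix has the same
   eigenvalues on rows and on columns.  The value is 0 when n = 0, since
   [sup set0 = 0]. *)
Definition specradius n (A : 'M[C]_n) : R :=
  sup [set Normc.normc a | a in [set a : C | eigenvalue A a]].

Definition penrose m n (A : 'M[C]_(m, n)) (X : 'M[C]_(n, m)) : Prop :=
  [/\ A *m X *m A = A, X *m A *m X = X,
      (A *m X) ^t* = A *m X & (X *m A) ^t* = X *m A].

(* The default value 0 is never used: see [mpinvP] and [penrose_uniq]. *)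
Definition mpinv m n (A : 'M[C]_(m, n)) : 'M[C]_(n, m) :=
  xget 0 [set X | penrose A X].

Definition partial_isometry m n (U : 'M[C]_(m, n)) : Prop :=
  forall x : 'cV[C]_n, (forall y, nullmx U y -> inner x y = 0) ->
  enorm (U *m x) = enorm x.

Definition is_absmx m n (T : 'M[C]_(m, n)) (A : 'M[C]_n) : Prop :=
  psdmx A /\ A *m A = T ^t* *m T.

Definition polar_decomposition m n (T U : 'M[C]_(m, n)) (A : 'M[C]_n) : Prop :=
  [/\ T = U *m A, is_absmx T A, partial_isometry U & rangemx U = rangemx T].

Definition proper_splitting m n (T U V : 'M[C]_(m, n)) : Prop :=
  [/\ T = U - V, rangemx U = rangemx T & nullmx U = nullmx T].

Definition convergent_splitting m n (T U V : 'M[C]_(m, n)) : Prop :=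
  proper_splitting T U V /\ specradius (mpinv U *m V) < 1.

Lemma adjmxM m n p (A : 'M[C]_(m, n)) (B : 'M[C]_(n, p)) :
  (A *m B) ^t* = B ^t* *m A ^t*.
Proof. by rewrite trmx_mul map_mxM. Qed.

Lemma penrose_uniq m n (A : 'M[C]_(m, n)) X Y :
  penrose A X -> penrose A Y -> X = Y.
Proof.
move=> [X1 X2 X3 X4] [Y1 Y2 Y3 Y4].
have eAX : A *m X = A *m Y.
  by rewrite -X3 -{1}Y1 -mulmxA adjmxM X3 Y3 mulmxA X1.
have eXA : X *m A = Y *m A.
  by rewrite -X4 -{1}Y1 -!mulmxA mulmxA adjmxM X4 Y4 -mulmxA (mulmxA A) X1.
by rewrite -X2 -mulmxA eAX mulmxA eXA.
Qed.

Lemma gram_unit m n (B : 'M[C]_(m, n)) : row_free B -> B *m B ^t* \in unitmx.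
Proof.
move=> Bfree; rewrite -row_free_unit; apply: inj_row_free => v vBB.
apply: (row_free_inj Bfree); rewrite mul0mx.
apply/eqP; rewrite -(dnorm_eq0 (@dotmx C n)) /= dotmxE adjmxM mulmxA.
by rewrite -(mulmxA v) vBB mul0mx mxE.
Qed.

Lemma penrose_ex m n (A : 'M[C]_(m, n)) : exists X, penrose A X.
Proof.
have [r [D [B [eA fullD freeB]]]] :
    exists r (D : 'M[C]_(m, r)) (B : 'M[C]_(r, n)),
      [/\ A = D *m B, row_full D & row_free B].
  by exists (\rank A), (col_base A), (row_base A);
    rewrite mulmx_base col_base_full row_base_free; split.
have uB : B *m B ^t* \in unitmx by exact: gram_unit.
have uD : D ^t* *m D \in unitmx.
  rewrite -{2}(trmxCK D); apply: gram_unit.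
  rewrite /row_free mxrank_map mxrank_tr; exact: fullD.
have hermV k (M : 'M[C]_k) : M ^t* = M -> (invmx M) ^t* = invmx M.
  by move=> hM; rewrite trmx_inv map_invmx hM.
have hB : (B *m B ^t*) ^t* = B *m B ^t* by rewrite adjmxM trmxCK.
have hD : (D ^t* *m D) ^t* = D ^t* *m D by rewrite adjmxM trmxCK.
pose G := invmx (B *m B ^t*); pose H := invmx (D ^t* *m D).
pose X := B ^t* *m G *m (H *m D ^t*).
have AX : A *m X = D *m (H *m D ^t*).
  by rewrite eA /X !mulmxA -(mulmxA D B) -(mulmxA D) mulmxV // mulmx1.
have XA : X *m A = B ^t* *m G *m B.
  by rewrite eA /X -!mulmxA (mulmxA _ D B) (mulmxA H) mulVmx // mul1mx.
exists X; split.
- by rewrite AX {1}eA -!mulmxA (mulmxA _ D B) (mulmxA H) mulVmx // mul1mx eA.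
- rewrite XA /X -!mulmxA (mulmxA B) (mulmxA _ (B *m _)) mulVmx //.
  by rewrite mul1mx.
- by rewrite AX !adjmxM trmxCK hermV // mulmxA.
- by rewrite XA !adjmxM trmxCK hermV // mulmxA.
Qed.

Lemma mpinvP m n (A : 'M[C]_(m, n)) : penrose A (mpinv A).
Proof. by rewrite /mpinv; case: xgetP (penrose_ex A) => // + [X] => /(_ X). Qed.

End Definitions.

(* Main.v *)
(** Diagonalise [|T| = Q^* diag(d) Q] with [Q] unitary and [d >= 0], and let
    [e_i] be 0 if [d_i = 0] and 1 otherwise.  Since [U_T^* U_T] is the
    orthogonal projection onto the range of [|T|], the matrices
    [U_T^* U_T = T^dagger T], [U_T^* T = |T|] and [T^dagger U_T = |T|^dagger]
    are all diagonal in the basis [Q], so that [U_T^* V] and [T^dagger V] have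
    the eigenvalues [e_i - d_i] and [d_i^-1 - e_i] (where [0^-1 = 0]).  Each of
    the three conditions thus says that [d_i <= 1] for all [i], and then the
    eigenvalues [e_i - d_i] of [U_T^dagger V = U_T^* V] are nonnegative and
    less than 1. *)

From HB Require Import structures.
Require Import Defs.
From mathcomp Require Import all_boot all_order all_algebra.
From mathcomp Require Import boolp classical_sets reals complex.
Set Implicit Arguments.
Unset Strict Implicit.
Unset Printing Implicit Defensive.
Import Order.TTheory GRing.Theory Num.Theory.
Local Open Scope ring_scope.
Local Open Scope sesquilinear_scope.
Local Open Scope complex_scope.

(** * Inner product, quadratic forms and positive semidefinite matrices *)

Section InnerProduct.
Context {R : realType}.
Local Notation C := R[i].

Lemma innerE n (x y : 'cV[C]_n) : inner x y = \sum_i x i 0 * Num.conj (y i 0).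
Proof. by rewrite /inner mxE; apply: eq_bigr => i _; rewrite !mxE mulrC. Qed.

Lemma inner_normE n (x : 'cV[C]_n) : inner x x = \sum_i `|x i 0| ^+ 2.
Proof. by rewrite innerE; apply: eq_bigr => i _; rewrite normCK. Qed.

Lemma inner_ge0 n (x : 'cV[C]_n) : 0 <= inner x x.
Proof. by rewrite inner_normE sumr_ge0 // => i _; rewrite exprn_ge0. Qed.

Lemma inner_conj n (x y : 'cV[C]_n) : Num.conj (inner x y) = inner y x.
Proof.
rewrite !innerE rmorph_sum; apply: eq_bigr => i _.
by rewrite rmorphM /= conjCK mulrC.
Qed.

Lemma inner_adj m n (A : 'M[C]_(m, n)) (x : 'cV[C]_n) (y : 'cV[C]_m) :
  inner (A *m x) y = inner x (A ^t* *m y).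
Proof. by rewrite /inner adjmxM trmxCK mulmxA. Qed.

Lemma innerDl n (x y z : 'cV[C]_n) : inner (x + y) z = inner x z + inner y z.
Proof. by rewrite /inner mulmxDr mxE. Qed.

Lemma innerDr n (x y z : 'cV[C]_n) : inner z (x + y) = inner z x + inner z y.
Proof. by rewrite -(inner_conj (x + y)) innerDl rmorphD /= !inner_conj. Qed.

Lemma innerZl n a (x y : 'cV[C]_n) : inner (a *: x) y = a * inner x y.
Proof. by rewrite /inner -scalemxAr mxE. Qed.

Lemma innerZr n a (x y : 'cV[C]_n) : inner x (a *: y) = Num.conj a * inner x y.
Proof. by rewrite -(inner_conj (a *: y)) innerZl rmorphM /= inner_conj. Qed.

Lemma innerNl n (x y : 'cV[C]_n) : inner (- x) y = - inner x y.
Proof. by rewrite -scaleN1r innerZl mulN1r. Qed.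

Lemma inner0r n (x : 'cV[C]_n) : inner x 0 = 0.
Proof. by rewrite /inner trmx0 map_mx0 mul0mx mxE. Qed.

Lemma enorm_sqr n (x : 'cV[C]_n) : ((enorm x) ^+ 2)%:C = inner x x.
Proof.
have := inner_ge0 x; rewrite lecE /= => /andP[_ re0].
by rewrite /enorm sqr_sqrtr // RRe_real // ger0_real // inner_ge0.
Qed.

Lemma enorm_le1 n (x : 'cV[C]_n) : (enorm x <= 1) = (inner x x <= 1).
Proof.
rewrite -enorm_sqr -[1 in RHS]/(1%:C) lecR expr_le1 //; exact: sqrtr_ge0.
Qed.

(** Complex polarization: the form at [x + y] makes [inner (B *m x) y] and [inner (B *m y) x]
    opposite, and the form at [x + 'i *: y] makes them equal. Basis vectors then read off the
    entries. *)
Lemma quadratic_form_eq0 n (B : 'M[C]_n) :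
  (forall x, inner (B *m x) x = 0) -> B = 0.
Proof.
move=> B0.
have polar x y : inner (B *m x) y = 0.
  have := B0 (x + y); have := B0 (x + 'i%R *: y).
  rewrite !mulmxDr -!scalemxAr !innerDl !innerDr !innerZl !innerZr !B0.
  rewrite conjCi !mulr0 !addr0 !add0r mulNr addrC -mulrBr => /eqP.
  rewrite mulf_eq0 (negPf (neq0Ci _)) subr_eq0 => /eqP ->.
  by rewrite -mulr2n => /eqP; rewrite mulrn_eq0 => /eqP.
apply/matrixP => i j; rewrite mxE -(polar (delta_mx j 0) (delta_mx i 0)).
rewrite innerE -colE (bigD1 i) //= big1 ?addr0.
  by rewrite !mxE !eqxx conjC1 mulr1.
by move=> k kNi; rewrite !mxE (negPf kNi) conjC0 mulr0.
Qed.

(** A real-valued form equals its conjugate, which is the form of the adjoint; so the form of the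
    difference vanishes. *)
Lemma psdmx_herm n (A : 'M[C]_n) : psdmx A -> A ^t* = A.
Proof.
move=> Apsd; apply/esym/eqP; rewrite -subr_eq0; apply/eqP.
apply: quadratic_form_eq0 => x; rewrite mulmxBl innerDl innerNl.
rewrite -[X in - X]inner_conj -inner_adj.
by rewrite (CrealP (ger0_real (Apsd x))) subrr.
Qed.

Lemma adjmx_mul_eq0 m n (B : 'M[C]_(m, n)) : B ^t* *m B = 0 -> B = 0.
Proof.
move=> BB; have {}BB (x : 'cV_n) : B *m x = 0.
  have : inner (B *m x) (B *m x) = 0.
    by rewrite inner_adj mulmxA BB mul0mx inner0r.
  rewrite inner_normE => /psumr_eq0P h; apply/colP => i; rewrite !mxE.
  have /eqP := h (fun j _ => exprn_ge0 2 (normr_ge0 _)) i isT.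
  by rewrite expf_eq0 /= normr_eq0 => /eqP; rewrite mxE.
by apply/matrixP => i j; have /colP/(_ i) := BB (delta_mx j 0);
  rewrite -colE !mxE.
Qed.

End InnerProduct.

(* Locked: unfolding it makes conversion over [R[i]] prohibitively slow. *)
HB.lock Definition udiag (C : numClosedFieldType) n (Q : 'M[C]_n)
  (f : 'I_n -> C) : 'M[C]_n := Q ^t* *m diag_mx (\row_i f i) *m Q.

(** * Algebra of matrices diagonal in a fixed unitary basis *)

Section UnitaryDiagonalization.
Context {C : numClosedFieldType} {n : nat} {Q : 'M[C]_n}.
Hypothesis Qunitary : Q \is unitarymx.
Implicit Types f g : 'I_n -> C.

Lemma unitarymxV : Q ^t* *m Q = 1%:M. Proof. exact/mulmx1C/unitarymxP. Qed.

Lemma eq_udiag f g : f =1 g -> udiag Q f = udiag Q g.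
Proof. by move=> /funext ->. Qed.

Lemma udiagM f g : udiag Q f *m udiag Q g = udiag Q (fun i => f i * g i).
Proof.
rewrite !udiag.unlock -!mulmxA (mulmxA Q) (unitarymxP Qunitary) mul1mx.
rewrite (mulmxA (diag_mx _)) mulmx_diag.
by congr (_ *m (diag_mx _ *m _)); apply/rowP => i; rewrite !mxE.
Qed.

Lemma udiagB f g : udiag Q f - udiag Q g = udiag Q (fun i => f i - g i).
Proof.
rewrite !udiag.unlock -mulmxBl -mulmxBr -linearB /=.
by congr (_ *m diag_mx _ *m _); apply/rowP => i; rewrite !mxE.
Qed.

Lemma udiag_adj f : (udiag Q f) ^t* = udiag Q (fun i => Num.conj (f i)).
Proof.
rewrite !udiag.unlock !trmx_mul !map_mxM /= trmxCK tr_diag_mx map_diag_mx.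
rewrite mulmxA.
by congr (_ *m diag_mx _ *m _); apply/rowP => i; rewrite !mxE.
Qed.

(** As [0^-1 = 0], inverting the diagonal entrywise gives the Moore-Penrose inverse. The lemmas from
    here to [udiag_support_adj] amount to its Penrose equations, the indicator of the support being
    the range projection. *)
Lemma udiag_divff f :
  udiag Q f *m udiag Q (fun i => (f i)^-1) = udiag Q (fun i => (f i != 0)%:R).
Proof.
rewrite udiagM; apply: eq_udiag => i.
by have [->|fi0] := eqVneq (f i) 0; rewrite ?mul0r ?divff.
Qed.

Lemma udiag_mulVf f :
  udiag Q (fun i => (f i)^-1) *m udiag Q f = udiag Q (fun i => (f i != 0)%:R).
Proof.
by rewrite -udiag_divff !udiagM; apply: eq_udiag => i; rewrite mulrC.
Qed.

Lemma udiag_support_mul f :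
  udiag Q (fun i => (f i != 0)%:R) *m udiag Q f = udiag Q f.
Proof.
rewrite udiagM; apply: eq_udiag => i.
by have [->|fi0] := eqVneq (f i) 0; rewrite ?mul0r ?mul1r.
Qed.

Lemma udiag_mul_support f :
  udiag Q f *m udiag Q (fun i => (f i != 0)%:R) = udiag Q f.
Proof.
by rewrite -[RHS]udiag_support_mul !udiagM; apply: eq_udiag => i; rewrite mulrC.
Qed.

Lemma udiag_support_mulV f :
  udiag Q (fun i => (f i != 0)%:R) *m udiag Q (fun i => (f i)^-1) =
  udiag Q (fun i => (f i)^-1).
Proof.
rewrite -[RHS]udiag_support_mul; congr (_ *m _); apply: eq_udiag => i.
by rewrite invr_eq0.
Qed.

Lemma udiag_mulV_support f :
  udiag Q (fun i => (f i)^-1) *m udiag Q (fun i => (f i != 0)%:R) =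
  udiag Q (fun i => (f i)^-1).
Proof.
rewrite -[RHS]udiag_support_mulV !udiagM; apply: eq_udiag => i.
by rewrite mulrC.
Qed.

Lemma udiag_support_adj f :
  (udiag Q (fun i => (f i != 0)%:R)) ^t* = udiag Q (fun i => (f i != 0)%:R).
Proof. by rewrite udiag_adj; apply: eq_udiag => i; rewrite conjC_nat. Qed.

(** In the basis [Q] the eigenvector stays nonzero, and any nonzero coordinate [i] forces
    [a = f i]. *)
Lemma eigenvalue_udiag f a : eigenvalue (udiag Q f) a -> exists i, a = f i.
Proof.
case/eigenvalueP => v va v0; pose w := v *m Q ^t*.
have wa : w *m diag_mx (\row_i f i) = a *: w.
  rewrite /w scalemxAl -va udiag.unlock -!mulmxA (unitarymxP Qunitary).
  by rewrite mulmx1.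
have [i wi] : exists i, w 0 i != 0.
  apply/existsP; apply: contraNT v0 => /existsPn w0.
  have {}w0 : w = 0.
    by apply/rowP => i; rewrite [RHS]mxE; apply/eqP/negbNE; exact: w0.
  by rewrite -(mulmx1 v) -unitarymxV mulmxA -/w w0 mul0mx.
exists i; apply: (mulIf wi).
have /rowP/(_ i) := wa; rewrite mul_mx_diag [RHS]mxE => <-.
by rewrite !mxE mulrC.
Qed.

End UnitaryDiagonalization.

Lemma normalmx_udiag (C : numClosedFieldType) n (A : 'M[C]_n) :
  A \is normalmx -> A = udiag (spectralmx A) (fun i => spectral_diag A 0 i).
Proof.
move=> /orthomx_spectralP AE.
rewrite [LHS]AE invmx_unitary ?spectral_unitarymx // udiag.unlock.
by congr (_ *m diag_mx _ *m _); apply/rowP => i; rewrite mxE.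
Qed.

(** * Positivity, spectral radius and spectral norm read off the diagonal *)

Section UnitaryDiagonalizationComplex.
Context {R : realType} {n : nat} {Q : 'M[R[i]]_n}.
Hypothesis Qunitary : Q \is unitarymx.
Local Notation C := R[i].
Implicit Types f : 'I_n -> C.

Lemma inner_udiag f x :
  inner (udiag Q f *m x) x = \sum_i f i * `|(Q *m x) i 0| ^+ 2.
Proof.
rewrite udiag.unlock -!mulmxA inner_adj trmxCK innerE; apply: eq_bigr => i _.
by rewrite mul_diag_mx !mxE -mulrA normCK.
Qed.

Lemma inner_unitary x : inner x x = \sum_i `|(Q *m x) i 0| ^+ 2.
Proof.
by rewrite -inner_normE inner_adj mulmxA (unitarymxV Qunitary) mul1mx.
Qed.

(** The unit eigenvector for [f i]: testing a form on it isolates that coefficient. *)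
Let ev i : 'cV[C]_n := Q ^t* *m delta_mx i 0.

Let sum_ev f i : \sum_j f j * `|(Q *m ev i) j 0| ^+ 2 = f i.
Proof.
rewrite /ev mulmxA (unitarymxP Qunitary) mul1mx (bigD1 i) //= big1 ?addr0.
  by rewrite mxE !eqxx normr1 expr1n mulr1.
by move=> j jNi; rewrite mxE (negPf jNi) normr0 expr0n mulr0.
Qed.

Lemma psd_udiag f : psdmx (udiag Q f) <-> forall i, 0 <= f i.
Proof.
split=> [psd i|f0 x]; first by have := psd (ev i); rewrite inner_udiag sum_ev.
by rewrite inner_udiag sumr_ge0 // => i _; rewrite mulr_ge0 ?exprn_ge0.
Qed.

Lemma specradius_udiag_lt1 f :
  (forall i, 0 <= f i < 1) -> specradius (udiag Q f) < 1.
Proof.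
move=> f01; rewrite /specradius; set S := image _ _.
have [->|/set0P S0] := eqVneq S set0; first by rewrite sup0.
(* A supremum of numbers below 1 could be 1, so strictness comes from a maximum over finitely many
   indices. *)
pose b : R := \big[Num.max/0]_i complex.Re (f i).
have b1 : b < 1.
  rewrite /b; apply: (big_ind (fun x => x < 1)) => // [x y x1 y1|i _].
    by rewrite gt_max x1.
  by have /andP[_] := f01 i; rewrite ltcE => /andP[].
apply: le_lt_trans b1.
apply: ge_sup => // _ [a /(eigenvalue_udiag Qunitary)[i ->] <-].
have /andP[fi0 _] := f01 i.
have -> : Normc.normc (f i) = complex.Re (f i).
  apply: complexI; rewrite RRe_real ?ger0_real //.
  exact: (ger0_norm fi0).
exact: le_bigmax.
Qed.

Lemma specnorm_udiag_le1 m (T : 'M[C]_(m, n)) f : T ^t* *m T = udiag Q f ->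
  specnorm T <= 1 <-> forall i, f i <= 1.
Proof.
move=> TT.
have innerT x : inner (T *m x) (T *m x) = \sum_i f i * `|(Q *m x) i 0| ^+ 2.
  by rewrite -inner_udiag -TT -mulmxA [RHS]inner_adj trmxCK.
have f0 i : 0 <= f i by rewrite -(sum_ev f) -innerT inner_ge0.
(* A crude bound for the squared norms on the unit ball; it only serves to show that the supremum is
   taken over a bounded set. *)
pose b := \sum_i f i; have b0 : 0 <= b by rewrite sumr_ge0.
have ub x : enorm x <= 1 -> inner (T *m x) (T *m x) <= b.
  rewrite enorm_le1 => x1; rewrite innerT; apply: ler_sum => i _.
  rewrite ler_piMr //; apply: le_trans x1; rewrite inner_unitary.
  by rewrite (bigD1 i) //= lerDl sumr_ge0 // => j _; rewrite exprn_ge0.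
split=> [T1 i|f1].
  have evi1 : inner (ev i) (ev i) = 1.
    by rewrite inner_unitary -[RHS](sum_ev (fun=> 1) i); apply: eq_bigr => j _;
      rewrite mul1r.
  rewrite -(sum_ev f) -innerT -enorm_le1; apply: le_trans T1.
  apply: ub_le_sup; last by exists (ev i) => //=; rewrite enorm_le1 evi1.
  (* Avoids a square root: a squared norm at most [b] is at most [(b + 1) ^+ 2]. *)
  exists (complex.Re b + 1) => _ [x /ub x1 <-].
  have bR : (complex.Re b)%:C = b by rewrite RRe_real ?ger0_real.
  have Re0 : 0 <= complex.Re b by rewrite -ler0c bR.
  rewrite -(@ler_pXn2r _ 2) ?nnegrE ?sqrtr_ge0 ?addr_ge0 //.
  apply: (@le_trans _ _ (complex.Re b)); first by rewrite -lecR enorm_sqr bR.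
  by apply: le_trans (ler_eXnr _ _); rewrite ?lerDl ?lerDr.
apply: ge_sup.
  exists (enorm (T *m 0)), 0 => //=.
  by rewrite enorm_le1 inner0r ler01.
move=> _ [x /= x1 <-]; rewrite enorm_le1; move: x1; rewrite enorm_le1.
apply: le_trans; rewrite innerT inner_unitary; apply: ler_sum => i _.
by rewrite ler_piMl ?exprn_ge0.
Qed.

End UnitaryDiagonalizationComplex.

(** * Spectral form of the polar decomposition *)

Lemma psdmx_spectral (R : realType) n (A : 'M[R[i]]_n) : psdmx A ->
  exists Q (d : 'I_n -> R[i]),
    [/\ Q \is unitarymx, A = udiag Q d & forall i, 0 <= d i].
Proof.
move=> Apsd; have Anormal : A \is normalmx.
  by apply/normalmxP; rewrite psdmx_herm.
have Qu := spectral_unitarymx A.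
have AE := normalmx_udiag Anormal.
exists (spectralmx A), (fun i => spectral_diag A 0 i); split=> //.
by apply/(psd_udiag Qu); rewrite -AE.
Qed.

Lemma mpinv_unique (R : realType) m n (A : 'M[R[i]]_(m, n)) X :
  penrose A X -> mpinv A = X.
Proof. exact/penrose_uniq/mpinvP. Qed.

(** With [Z] the Moore-Penrose inverse, [Z *m U] projects orthogonally onto the complement of the
    nullspace, where [U] is isometric. So [U ^t* *m U] and [Z *m U] have the same quadratic form and
    coincide. *)
Lemma partial_isometry_adj (R : realType) m n (U : 'M[R[i]]_(m, n)) :
  partial_isometry U -> penrose U (U ^t*).
Proof.
move=> Uiso; have [P1 P2 _ P4] := mpinvP U; set Z := mpinv U in P1 P2 P4.
have UU : U ^t* *m U = Z *m U.
  apply/eqP; rewrite -subr_eq0; apply/eqP; apply: quadratic_form_eq0 => x.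
  rewrite mulmxBl innerDl innerNl.
  have <- : inner (Z *m U *m x) (Z *m U *m x) = inner (Z *m U *m x) x.
    by rewrite inner_adj P4 [RHS]inner_adj P4 mulmxA (mulmxA _ Z) P2.
  rewrite -enorm_sqr -Uiso; last first.
    by move=> y Uy0; rewrite inner_adj P4 -mulmxA Uy0 mulmx0 inner0r.
  by rewrite enorm_sqr !mulmxA P1 -mulmxA [X in X - _]inner_adj trmxCK subrr.
split; try by rewrite adjmxM trmxCK.
- by rewrite -mulmxA UU mulmxA P1.
- by rewrite UU -P4 -adjmxM mulmxA P1.
Qed.

Lemma polar_spectral (R : realType) m n (T U : 'M[R[i]]_(m, n)) A :
  polar_decomposition T U A ->
  exists Q (d : 'I_n -> R[i]),
    [/\ Q \is unitarymx, A = udiag Q d, forall i, 0 <= d i,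
        U ^t* *m U = udiag Q (fun i => (d i != 0)%:R) &
        mpinv T = udiag Q (fun i => (d i)^-1) *m U ^t*].
Proof.
case=> TUA [Apsd AA] /partial_isometry_adj[P1 P2 _ P4] rangeUT.
have Ah := psdmx_herm Apsd.
have [Q [d [Qu AE d0]]] := psdmx_spectral Apsd.
set P := U ^t* *m U in P2 P4 *.
have PU : P = U ^t* *m U by []; clearbody P.
pose B := udiag Q (fun i => (d i)^-1).
pose E := udiag Q (fun i => (d i != 0)%:R).
have AB : A *m B = E by rewrite AE (udiag_divff Qu).
have BA : B *m A = E by rewrite AE (udiag_mulVf Qu).
have EA : E *m A = A by rewrite AE (udiag_support_mul Qu).
have EB : E *m B = B by exact: udiag_support_mulV.
have Eh : E ^t* = E by exact: udiag_support_adj.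
have PP : P *m P = P by rewrite {2}PU mulmxA P2.
have APA : A *m P *m A = A *m A.
  by rewrite AA TUA adjmxM Ah PU !mulmxA.
have PA : P *m A = A.
  (* The Gram matrix of [A - P *m A] expands to [A *m A - A *m P *m A], which is zero by [APA]. *)
  apply/esym/eqP; rewrite -subr_eq0; apply/eqP/adjmx_mul_eq0.
  have -> : (A - P *m A) ^t* = A - A *m P.
    by rewrite [_^T]linearB /= map_mxB adjmxM P4 Ah.
  rewrite mulmxBl !mulmxBr !mulmxA APA.
  by rewrite -(mulmxA A P P) PP APA subrr.
(* Each column of [U] lies in the range of [T]; the chosen preimages are the columns of [Y]. *)
have [Y UTY] : exists Y, U = T *m Y.
  have /choice[y yP] j : exists y, T *m y = col j U.
    have : rangemx U (col j U) by exists (delta_mx j 0); rewrite // colE.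
    by rewrite rangeUT => -[y _ yE]; exists y.
  exists (\matrix_(i, j) y j i 0); apply/matrixP => i j.
  have /colP/(_ i) := yP j; rewrite !mxE => <-.
  by apply: eq_bigr => k _; rewrite !mxE.
(* The range hypothesis writes [P] as [A *m Y], so that [P] and the projection
   [E] onto the range of [A] absorb each other. *)
have PE : P = E.
  have PAY : P = A *m Y by rewrite PU {2}UTY TUA !mulmxA -PU PA.
  have EP : E *m P = P by rewrite PAY mulmxA EA.
  have PEE : P *m E = E by rewrite -AB mulmxA PA.
  by rewrite -EP -{1}Eh -P4 -adjmxM PEE Eh.
exists Q, d; split=> //; apply: mpinv_unique.
have TX : T *m (B *m U ^t*) = U *m E *m U ^t*.
  by rewrite TUA !mulmxA -(mulmxA U) AB.
have XT : B *m U ^t* *m T = E.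
  by rewrite TUA mulmxA -(mulmxA B) -PU -mulmxA PA BA.
split.
- by rewrite -mulmxA XT TUA -mulmxA {1}AE (udiag_mul_support Qu) -AE.
- by rewrite XT mulmxA EB.
- by rewrite TX !adjmxM trmxCK Eh mulmxA.
- by rewrite XT Eh.
Qed.

Theorem proposition7p3 (R : realType) (m n : nat)
    (T UT V : 'M[R[i]]_(m, n)) (absT : 'M[R[i]]_n)
    (hpolar : polar_decomposition T UT absT) (hV : V = UT - T) :
  proper_splitting T UT V /\
  (psdmx (mpinv T *m V) <-> psdmx (UT ^t* *m V)) /\
  (psdmx (UT ^t* *m V) <-> specnorm T <= 1) /\
  (psdmx (mpinv T *m V) \/ psdmx (UT ^t* *m V) \/ specnorm T <= 1 ->
   convergent_splitting T UT V).
Proof.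
have [Q [d [Qu AE d0 PE TdE]]] := polar_spectral hpolar.
case: hpolar => TUA [_ AA] Uiso rangeUT.
have Upen := partial_isometry_adj Uiso.
have UtT : UT ^t* *m T = udiag Q d.
  by rewrite TUA mulmxA PE AE (udiag_support_mul Qu).
have UtV : UT ^t* *m V = udiag Q (fun i => (d i != 0)%:R - d i).
  by rewrite hV mulmxBr PE UtT udiagB.
have TdV : mpinv T *m V = udiag Q (fun i => (d i)^-1 - (d i != 0)%:R).
  rewrite hV mulmxBr {1 2}TdE -!mulmxA PE UtT.
  by rewrite (udiag_mulVf Qu) (udiag_mulV_support Qu) udiagB.
have d1b : psdmx (UT ^t* *m V) <-> forall i, d i <= 1.
  rewrite UtV psd_udiag //; split=> h i; move: (h i);
    have [->|di0] := eqVneq (d i) 0; rewrite ?subr_ge0 ?ler01 ?lexx //.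
have d1a : psdmx (mpinv T *m V) <-> forall i, d i <= 1.
  rewrite TdV psd_udiag //; split=> h i; move: (h i);
    have [->|di0] := eqVneq (d i) 0; rewrite ?subr_ge0 ?invr0 ?ler01 ?lexx //;
    by rewrite invf_ge1 // lt_def di0 d0.
have d1c : specnorm T <= 1 <-> forall i, d i <= 1.
  (* The Gram matrix of [T] is the square of [absT], and [d i ^+ 2 <= 1] means [d i <= 1] because
     [d i] is nonnegative. *)
  rewrite (specnorm_udiag_le1 Qu (f := fun i => d i * d i)).
    by split=> h i; have := h i; rewrite -expr2 expr_le1.
  by rewrite -AA AE (udiagM Qu).
have AP : absT *m (UT ^t* *m UT) = absT.
  by rewrite PE AE (udiag_mul_support Qu).
have [P1 _ _ _] := Upen.
have splitting : proper_splitting T UT V.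
  split=> //; first by rewrite hV subKr.
  (* Each of [T] and [UT] is a left multiple of the other: [T = UT *m absT *m UT ^t* *m UT], and
     [UT] is [UT *m B *m UT ^t* *m T] with [B] the Moore-Penrose inverse of [absT]. *)
  apply/seteqP; split=> x; rewrite /nullmx /= => x0.
    by rewrite TUA -AP -!mulmxA x0 !mulmx0.
  by rewrite -P1 -(mulmxA UT) PE -(udiag_mulVf Qu) -UtT -!mulmxA x0 !mulmx0.
split; first exact: splitting.
split; first by rewrite d1a d1b.
split; first by rewrite d1b d1c.
rewrite d1a d1b d1c => hd; have {}hd i : d i <= 1 by case: hd => [|[]].
split; first exact: splitting.
rewrite (mpinv_unique Upen) UtV.
apply: specradius_udiag_lt1 => // i.
have [->|di0] := eqVneq (d i) 0; first by rewrite subrr lexx ltr01.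
by rewrite subr_ge0 hd /= ltrBlDr ltrDl lt_def di0 d0.
Qed.
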